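(* Let $a>1$, $n\ge1$, $(x,u,\eta)\in\mathbb{R}^3$ and $\omega_j:=1-\frac{2j}{n}$. For integers $k,m\ge0$, let $S_n^{h_k,x}(t,a)=h_k(t-x)F_n(t,a)$. Then $$V_{h_m}(S_n^{h_k,x})(u,\eta)=i^{k+m}\sum_{j=0}^nC_j(n,a)\,(M_xh_k*M_uh_m)(\omega_j-\eta).$$
   Context: Hermite functions: $h_m(t)=e^{-t^2/2}H_m(t)=(-1)^me^{t^2/2}\frac{d^m}{dt^m}(e^{-t^2})$. Modulation: $(M_\omega f)(t)=e^{i\omega t}f(t)$. Convolution: $(f*g)(\lambda)=\int_{\mathbb{R}}f(s)g(\lambda-s)\,ds$. The short-time Fourier transform of $f\in L^2(\mathbb{R})$ with window $g\in L^2(\mathbb{R})$ is $V_g(f)(x,\omega)=\int_{\mathbb{R}}e^{-it\omega}\overline{g(t-x)}f(t)\,dt$. The superoscillating sequence is $F_n(t,a)=\sum_{j=0}^nC_j(n,a)e^{i(1-2j/n)t}$ with $C_j(n,a)=\binom{n}{j}\left(\frac{1+a}{2}\right)^{n-j}\left(\frac{1-a}{2}\right)^j$. *)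

(* Defs.v *)
From mathcomp Require Import all_boot all_order all_algebra.
From mathcomp Require Import complex.
From mathcomp Require Import all_classical all_reals all_analysis.

Set Implicit Arguments.
Unset Strict Implicit.
Unset Printing Implicit Defensive.

Import Order.TTheory GRing.Theory Num.Theory.
Import numFieldNormedType.Exports.

Local Open Scope classical_set_scope.
Local Open Scope ring_scope.
Local Open Scope complex_scope.

(* e^{i theta} for real theta *)
Definition expi {R : realType} (theta : R) : R[i] := cos theta +i* sin theta.

(* Lebesgue integral over the line, componentwise; since [Rintegral] is total
   this is the integral of f only when f is integrable, as are all the
   integrands built below from Hermite functions. *)
Definition Cintegral {R : realType} (f : R -> R[i]) : R[i] :=
  (\int[@lebesgue_measure R]_t complex.Re (f t)) +i*
  (\int[@lebesgue_measure R]_t complex.Im (f t)).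

(* Physicists' normalization, not L2-normalized. *)
Definition hermite_fun {R : realType} (m : nat) (t : R) : R :=
  (-1) ^+ m * expR (t ^+ 2 / 2) * derive1n m gauss_fun t.

Definition hermite_funC {R : realType} (m : nat) (t : R) : R[i] :=
  (hermite_fun m t)%:C.

Definition modulation {R : realType} (omega : R) (f : R -> R[i]) (t : R) :
  R[i] := expi (omega * t) * f t.

Definition convol {R : realType} (f g : R -> R[i]) (lambda : R) : R[i] :=
  Cintegral (fun s => f s * g (lambda - s)).

Definition stft {R : realType} (g f : R -> R[i]) (x omega : R) : R[i] :=
  Cintegral (fun t => expi (- (t * omega)) * conjc (g (t - x)) * f t).

Definition so_freq (R : realType) (n j : nat) : R := 1 - 2 * j%:R / n%:R.

Definition so_coef {R : realType} (n : nat) (a : R) (j : nat) : R :=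
  'C(n, j)%:R * ((1 + a) / 2) ^+ (n - j) * ((1 - a) / 2) ^+ j.

Definition superosc {R : realType} (n : nat) (t a : R) : R[i] :=
  \sum_(j < n.+1) (so_coef n a j)%:C * expi (so_freq R n j * t).

Definition superosc_signal {R : realType} (n k : nat) (x t a : R) : R[i] :=
  hermite_funC k (t - x) * superosc n t a.

(* Main.v *)
Require Import Defs.
From mathcomp Require Import all_boot all_order all_algebra.
From mathcomp Require Import complex ring lra.
From mathcomp Require Import all_classical all_reals all_analysis measurable_realfun.

(** By linearity the transform is the sum over j of C_j times
      A = int exp(i l t) h_k(t - x) h_m(t - u) dt,   with l = omega_j - eta,
    so the content is the identity A = i^(k+m) B, where
      B = int exp(i x s) h_k(s) exp(i u (l - s)) h_m(l - s) ds
    is the convolution at l.  It amounts to the Hermite functions being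
    eigenfunctions of the Fourier transform, combined with the convolution
    theorem, but it is proved here without inversion or Fubini.

    Up to a constant phase, A and B are both Fourier transforms of a product
    h_k(t - p) h_m(e (t - q)): for A at frequency l, with e = 1, p = x, q = u; for
    B at frequency x - u, with e = -1, p = 0, q = l.  The derivative of a Hermite
    function has a raising and a lowering form,
      h_k' = t h_k - h_(k+1)   and   h_m' = - t h_m + 2 m h_(m-1).
    Using one form on each factor, the derivative of the product loses its
    unbounded coefficients, and integration by parts turns it into a recurrence in
    (k, m): [fourier_hermite_pairSl] and [fourier_hermite_pairSr].  The recurrences
    for A and for B differ exactly by the powers of i in the claim, so
    [fourier_hermite_pair_dual] follows by induction from the case k = m = 0.

    In that case the product is a translated Gaussian, and its transform is found
    by solving a linear differential equation in the frequency
    ([fourier_gauss_shift]).  All the integrations by parts rest on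
    [Rintegral_derive0]: the derivative of a function has integral 0 over the
    line, if both decay fast enough. *)

Set Implicit Arguments.
Unset Strict Implicit.
Unset Printing Implicit Defensive.

Import Order.TTheory GRing.Theory Num.Theory.
Import numFieldNormedType.Exports.

Local Open Scope ring_scope.
Local Open Scope complex_scope.

(** * Functions decaying faster than every exponential *)

(** A class of real integrands that contains the Hermite functions and is stable
    under sums, products, translations and multiplication by the variable, so
    that integrability never has to be examined case by case.  Decay against
    every exp(-k|t|) is used, rather than against a fixed Gaussian, because a
    translation then only costs a constant factor. *)
Definition fast_decay {R : realType} (r : R -> R) : Prop :=
  continuous r /\
  forall k : nat, exists M, forall t, expR (k%:R * `|t|) * `|r t| <= M.

Section FastDecay.
Local Open Scope classical_set_scope.
Local Open Scope ring_scope.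
Context {R : realType}.
Implicit Types r s b : R -> R.
Local Notation mu := (@lebesgue_measure R).

Lemma fast_decayD r s : fast_decay r -> fast_decay s ->
  fast_decay (fun t => r t + s t).
Proof.
move=> [cr dr] [cs ds]; split=> [t|k]; first by apply: cvgD; [exact: cr|exact: cs].
have [M hM] := dr k; have [N hN] := ds k; exists (M + N) => t.
apply: le_trans (lerD (hM t) (hN t)).
by rewrite -mulrDr ler_wpM2l ?expR_ge0 ?ler_normD.
Qed.

Lemma fast_decayMb b r M : continuous b -> (forall t, `|b t| <= M) ->
  fast_decay r -> fast_decay (fun t => b t * r t).
Proof.
move=> cb bM [cr dr]; split=> [t|k]; first by apply: cvgM; [exact: cb|exact: cr].
have [N hN] := dr k; exists (M * N) => t.
rewrite normrM mulrCA ler_pM ?mulr_ge0 ?expR_ge0//.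
Qed.

Lemma fast_decayZ c r : fast_decay r -> fast_decay (fun t => c * r t).
Proof. by apply: (@fast_decayMb (cst c) r `|c|) => // t; exact: cvg_cst. Qed.

Lemma fast_decayM r s : fast_decay r -> fast_decay s ->
  fast_decay (fun t => r t * s t).
Proof.
move=> [cr dr]; have [M hM] := dr 0%N; apply: (@fast_decayMb _ _ M) => // t.
by have := hM t; rewrite mul0r expR0 mul1r.
Qed.

(** Since |t| <= exp |t|, a factor t costs one unit of the exponential rate. *)
Lemma fast_decayX r : fast_decay r -> fast_decay (fun t => t * r t).
Proof.
move=> [cr dr]; split=> [t|k]; first by apply: cvgM; [exact: cvg_id|exact: cr].
have [N hN] := dr k.+1; exists N => t; apply: le_trans (hN t).
rewrite normrM mulrA ler_wpM2r// -natr1 mulrDl mul1r expRD.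
rewrite ler_wpM2l ?expR_ge0//.
by have := expR_ge1Dx `|t|; lra.
Qed.

(** The hypothesis on [rho] holds for the isometries of the line, which are the
    only changes of variable needed below. *)
Lemma fast_decay_comp r (rho : R -> R) c : continuous rho ->
  (forall t, `|t| <= c + `|rho t|) ->
  fast_decay r -> fast_decay (fun t => r (rho t)).
Proof.
move=> crho hc [cr dr]; split=> [t|k].
  by apply: (@continuous_comp _ _ _ rho r); [exact: crho|exact: cr].
have [N hN] := dr k; exists (expR (k%:R * c) * N) => t.
apply: (@le_trans _ _ (expR (k%:R * c) *
    (expR (k%:R * `|rho t|) * `|r (rho t)|))); last first.
  by rewrite ler_wpM2l ?expR_ge0.
by rewrite mulrA -expRD -mulrDr ler_wpM2r// ler_expR ler_wpM2l.
Qed.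

Lemma fast_decay_shift r c : fast_decay r -> fast_decay (fun t => r (t - c)).
Proof.
apply: (@fast_decay_comp _ _ `|c|) => [t|t].
  by apply: cvgB; [exact: cvg_id|exact: cvg_cst].
by apply: le_trans (ler_normD _ _); rewrite addrC subrK.
Qed.

Lemma integrable_oneDsqrV :
  mu.-integrable setT (EFin \o (fun t : R => (oneDsqr t)^-1)).
Proof.
have mf : measurable_fun setT (fun t : R => (oneDsqr t)^-1).
  by apply: continuous_measurable_fun; exact: continuous_oneDsqrV.
apply/integrableP; split; first exact/measurable_EFinP.
apply/abse_integralP => //=; first exact/measurable_EFinP.
rewrite ge0_symfun_integralT//.
- rewrite (_ : [set x | _] = `[0, +oo[%classic); last first.
    by apply/seteqP; split => x/=; rewrite in_itv/= andbT.
  by rewrite integral0y_oneDsqr -EFinM /= ltry.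
- exact: continuous_oneDsqrV.
- by move=> x/=; rewrite /oneDsqr sqrrN.
Qed.

(** The decay of rate 2 gives domination by a multiple of 1 / (1 + t^2), because
    exp(2|t|) >= (1 + |t|)^2 >= 1 + t^2. *)
Lemma fast_decay_integrable r : fast_decay r ->
  mu.-integrable setT (EFin \o r).
Proof.
move=> [cr dr]; have [M hM] := dr 2%N.
have mr : measurable_fun setT r by exact: continuous_measurable_fun.
apply: (@le_integrable _ _ _ mu _ measurableT _
  (EFin \o (fun t => M * (oneDsqr t)^-1))) => //.
- exact/measurable_EFinP.
- move=> t _ /=; rewrite lee_fin [leRHS]ger0_norm; last first.
    by rewrite mulr_ge0 ?invr_ge0// (le_trans _ (hM t))// mulr_ge0 ?expR_ge0.
  rewrite ler_pdivlMr ?oneDsqr_gt0//; apply: le_trans (hM t).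
  rewrite mulrC ler_wpM2r//.
  have -> : oneDsqr t = 1 + `|t| ^+ 2 by rewrite real_normK ?num_real.
  have h := expR_ge1Dx `|t|; have h0 : 0 <= `|t| by [].
  rewrite mulr_natl mulr2n expRD; nra.
- by apply: eq_integrable (integrableZl _ M integrable_oneDsqrV).
Qed.

Lemma fast_decay_cvgn (r : R -> R) (e : R) : `|e| = 1 -> fast_decay r ->
  r (e * n%:R) @[n --> \oo] --> 0.
Proof.
move=> e1 [cr dr]; have [M hM] := dr 1%N.
apply: norm_cvg0.
apply: (@squeeze_cvgr _ _ _ _ (cst 0) (fun n : nat => M * expR (- n%:R))).
- apply: nearW => n /=; rewrite normr_ge0/= expRN.
  rewrite ler_pdivlMr ?expR_gt0//; apply: le_trans (hM (e * n%:R)).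
  by rewrite mulrC mul1r normrM e1 mul1r ger0_norm.
- exact: cvg_cst.
- rewrite -[X in _ --> X](mulr0 M); apply: cvgM; first exact: cvg_cst.
  exact: cvgn_expR.
Qed.

(** There are no boundary terms at infinity: on [-n-1, n+1] the fundamental
    theorem of calculus gives r (n+1) - r (-n-1), which tends to 0, while the
    integrals converge to that over the line by domination.  Every integration
    by parts below is this lemma applied to a product. *)
Lemma Rintegral_derive0 r r' : (forall t : R, is_derive t (1 : R) r (r' t)) ->
  fast_decay r -> fast_decay r' -> \int[mu]_t r' t = 0.
Proof.
move=> dr Dr Dr'.
have ir' := fast_decay_integrable Dr'.
have cr : continuous r by case: Dr.
have cr' : continuous r' by case: Dr'.
(* the intervals start at [-1, 1], as the fundamental theorem wants a < b *)
pose A (n : nat) := `[(- n.+1%:R : R), n.+1%:R]%classic.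
have mr' : measurable_fun setT r' by exact: continuous_measurable_fun.
pose f_ n := EFin \o (r' \_ (A n)).
have FTC n : (\int[mu]_t f_ n t = (r n.+1%:R - r (- n.+1%:R))%:E)%E.
  rewrite /f_ -restrict_EFin -integral_mkcond (@continuous_FTC2 _ _ r)//.
  - by rewrite (@lt_trans _ _ 0) ?oppr_lt0 ?ltr0n.
  - exact: continuous_subspaceT.
  - split.
    + by move=> x _; apply: ex_derive.
    + by apply: cvg_at_right_filter; exact: cr.
    + by apply: cvg_at_left_filter; exact: cr.
  - by move=> x _; rewrite derive1E derive_val.
have [|||||_ _ lim1] := @dominated_convergence _ _ _ mu setT measurableT f_
  (EFin \o r') (abse \o (EFin \o r')).
- move=> n; have mA : measurable (A n) by exact: measurable_itv.
  apply/measurable_EFinP/(measurable_restrictT r' mA); exact: measurable_funTS.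
- exact/measurable_EFinP.
- apply: aeW => t _; apply: cvg_EFin; first exact: nearW.
  apply: cvg_near_cst; near=> n.
  rewrite /f_ /= patchE ifT// inE /A /= in_itv/= -ler_norml.
  near: n; exists (Num.bound `|t|) => //= n hn.
  rewrite (@le_trans _ _ (Num.bound `|t|)%:R)//; first exact/ltW/archi_boundP.
  by rewrite ler_nat ltnW.
- exact: integrable_abse.
- apply: aeW => t n _ /=; rewrite lee_fin /f_ patchE; case: ifP => //.
  by rewrite normr0.
have lim2 : (\int[mu]_t f_ n t)%E @[n --> \oo] --> 0%:E.
  under eq_fun do rewrite FTC.
  apply: cvg_EFin; first exact: nearW.
  have := @fast_decay_cvgn r 1 (normr1 _) Dr.
  have := @fast_decay_cvgn r (-1) (normrN1 _) Dr.
  rewrite -cvg_shiftS => h1; rewrite -cvg_shiftS => h2.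
  under eq_fun do rewrite -[X in r X]mul1r -mulN1r.
  have h := cvgB h2 h1; rewrite subr0 in h; exact: h.
by rewrite /Rintegral; have /= -> := cvg_unique _ lim1 lim2.
Unshelve. all: by end_near. Qed.

End FastDecay.

(** * Hermite functions *)

Section Hermite.
Local Open Scope classical_set_scope.
Local Open Scope ring_scope.
Context {R : realType}.
Local Notation gauss := (@gauss_fun R).
Local Notation Dgauss n := (derive1n n gauss).
Local Notation h := (@hermite_fun R).

Lemma is_derive_continuous (f f' : R -> R) :
  (forall t : R, is_derive t (1 : R) f (f' t)) -> continuous f.
Proof.
move=> df t; apply: differentiable_continuous; apply/derivable1_diffP.
by have [] := df t.
Qed.

Lemma is_derive_gauss (t : R) : is_derive t (1 : R) gauss (- (2 * t) * gauss t).
Proof.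
rewrite /gauss_fun; apply: is_derive_eq.
by rewrite /GRing.scale /=; ring.
Qed.

(** Differentiability and the three-term recurrence have to be proved together:
    the recurrence writes the derivative of order n+2 through the two previous
    ones, and this is what makes it differentiable in turn. *)
Lemma derive1n_gauss_rec n :
  (forall t : R, derivable (Dgauss n) t 1) /\
  (forall t : R, derivable (Dgauss n.+1) t 1) /\
  (forall t : R, (Dgauss n.+2) t =
     - (2 * t) * (Dgauss n.+1) t - 2 * n.+1%:R * (Dgauss n) t).
Proof.
have derivE m : (forall t : R, derivable (Dgauss m) t 1) ->
    forall t : R, is_derive t (1 : R) (Dgauss m) ((Dgauss m.+1) t).
  by move=> dm t; rewrite derive1nS derive1E; exact/derivableP/dm.
elim: n => [|n [dn [dn1 rec]]].
  have g1E : (Dgauss 1) = fun t : R => - (2 * t) * gauss t.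
    by apply/funext => t; rewrite derive1n1 derive1E; have [] := is_derive_gauss t.
  have dg (t : R) : derivable gauss t 1 by have [] := is_derive_gauss t.
  have dg1 (t : R) : is_derive t (1 : R) (Dgauss 1)
      (- (2 * t) * (Dgauss 1) t - 2 * 1 * gauss t).
    have dgt := is_derive_gauss t.
    rewrite g1E; apply: is_derive_eq.
    by rewrite /GRing.scale /=; ring.
  split=> //; split=> t; first by have [] := dg1 t.
  by rewrite derive1nS derive1E derive1n0; have [] := dg1 t.
have g2E : (Dgauss n.+2) = fun t : R =>
    - (2 * t) * (Dgauss n.+1) t - 2 * n.+1%:R * (Dgauss n) t by apply/funext.
have dg2 (t : R) : is_derive t (1 : R) (Dgauss n.+2)
    (- (2 * t) * (Dgauss n.+2) t - 2 * n.+2%:R * (Dgauss n.+1) t).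
  have dgt := derivE _ dn t; have dgt1 := derivE _ dn1 t.
  rewrite {1}g2E; apply: is_derive_eq.
  by rewrite /GRing.scale /= -[n.+2%:R]natr1; ring.
split; first exact: dn1.
split=> t; first by case: (dg2 t).
by rewrite derive1nS derive1E; case: (dg2 t).
Qed.

Lemma hermite_fun0 (t : R) : h 0 t = expR (- (t ^+ 2 / 2)).
Proof.
rewrite /hermite_fun expr0 mul1r derive1n0 /gauss_fun -expRD; congr expR.
by field.
Qed.

(** For [n = 0] the last term vanishes through its coefficient, whatever
    [h n.-1] means there; this keeps the recurrences below uniform in [n]. *)
Lemma hermite_funS n (t : R) : h n.+1 t = 2 * t * h n t - 2 * n%:R * h n.-1 t.
Proof.
rewrite /hermite_fun; case: n => [|n].
  rewrite derive1n1 derive1E derive1n0; have [_ ->] := is_derive_gauss t.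
  ring.
by have [_ [_ ->]] := derive1n_gauss_rec n; rewrite !exprS; ring.
Qed.

(** This is the raising form of the derivative; with [hermite_funS] it becomes
    the lowering form h_n' = - t h_n + 2 n h_(n-1).  The proof of the theorem
    plays one against the other. *)
Lemma is_derive_hermite n (t : R) :
  is_derive t (1 : R) (h n) (t * h n t - h n.+1 t).
Proof.
have dg : is_derive t (1 : R) (Dgauss n) ((Dgauss n.+1) t).
  rewrite derive1nS derive1E; apply/derivableP.
  by have [] := derive1n_gauss_rec n.
have de : is_derive t (1 : R) (fun t : R => expR (t ^+ 2 / 2))
    (t * expR (t ^+ 2 / 2)).
  apply: is_derive_eq; rewrite /GRing.scale /=.
  by field.
rewrite /hermite_fun; apply: is_derive_eq.
rewrite /GRing.scale /= !exprS. by ring.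
Qed.

Lemma fast_decay_hermite n : fast_decay (h n).
Proof.
(* two consecutive functions at a time, to follow the three-term recurrence *)
suff: fast_decay (h n) /\ fast_decay (h n.-1) by case.
elim: n => [|n [IH1 IH2]] /=.
  suff ? : fast_decay (h 0) by [].
  split; first exact: is_derive_continuous (is_derive_hermite 0).
  (* k|t| - t^2/2 <= k^2/2, by (k - |t|)^2 >= 0 *)
  move=> k; exists (expR (k%:R ^+ 2 / 2)) => t.
  rewrite hermite_fun0 [X in _ * X]ger0_norm ?expR_ge0// -expRD ler_expR.
  have -> : t ^+ 2 = `|t| ^+ 2 by rewrite real_normK ?num_real.
  have := sqr_ge0 (k%:R - `|t|); lra.
split=> //.
rewrite (_ : h n.+1 = fun t => 2 * (t * h n t) + - (2 * n%:R) * h n.-1 t).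
  by apply: fast_decayD; apply: fast_decayZ => //; exact: fast_decayX.
by apply/funext => t; rewrite hermite_funS; ring.
Qed.

End Hermite.

(** * Linearity of the complex integral *)

Section ComplexIntegral.
Context {R : realType}.
Implicit Types f g : R -> R[i].
Local Notation mu := (@lebesgue_measure R).

Lemma expiD (a b : R) : expi (a + b) = expi a * expi b.
Proof. by rewrite /expi cosD sinD; simpc; congr (_ +i* _); rewrite addrC. Qed.

Definition Cintegrable f :=
  mu.-integrable setT (EFin \o (fun t => complex.Re (f t))) /\
  mu.-integrable setT (EFin \o (fun t => complex.Im (f t))).

Lemma CintegrableD f g : Cintegrable f -> Cintegrable g ->
  Cintegrable (fun t => f t + g t).
Proof.
move=> [fr fi] [gr gi]; split.
  by apply: eq_integrable (integrableD _ fr gr) => // t _ /=; rewrite raddfD.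
by apply: eq_integrable (integrableD _ fi gi) => // t _ /=; rewrite raddfD.
Qed.

Lemma CintegralD f g : Cintegrable f -> Cintegrable g ->
  Cintegral (fun t => f t + g t) = Cintegral f + Cintegral g.
Proof.
move=> [fr fi] [gr gi]; rewrite /Cintegral; simpc.
congr (_ +i* _).
  by rewrite -RintegralD//; apply: eq_Rintegral => t _; rewrite raddfD.
by rewrite -RintegralD//; apply: eq_Rintegral => t _; rewrite raddfD.
Qed.

Lemma CintegrableZ (z : R[i]) f : Cintegrable f ->
  Cintegrable (fun t => z * f t).
Proof.
case: z => zr zi [fr fi]; split.
  apply: eq_integrable (integrableD _ (integrableZl _ zr fr)
    (integrableZl _ (- zi) fi)) => // t _ /=.
  by case: (f t) => ? ? /=; rewrite -!EFinM -EFinD mulNr.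
apply: eq_integrable (integrableD _ (integrableZl _ zr fi)
  (integrableZl _ zi fr)) => // t _ /=.
by case: (f t) => ? ? /=; rewrite -!EFinM -EFinD.
Qed.

Lemma CintegralZ (z : R[i]) f : Cintegrable f ->
  Cintegral (fun t => z * f t) = z * Cintegral f.
Proof.
case: z => zr zi [fr fi]; rewrite /Cintegral; simpc.
have ZI (c : R) (p : R -> R) : mu.-integrable setT (EFin \o p) ->
    mu.-integrable setT (EFin \o (fun t => c * p t)).
  by move=> ip; apply: eq_integrable (integrableZl _ c ip).
congr (_ +i* _).
  rewrite -!RintegralZl// -RintegralB//; [|exact: ZI..].
  by apply: eq_Rintegral => t _; case: (f t).
rewrite -!RintegralZl// -RintegralD//; [|exact: ZI..].
by apply: eq_Rintegral => t _; case: (f t).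
Qed.

Lemma Cintegral0 : Cintegral (fun _ : R => 0) = 0 :> R[i].
Proof. by rewrite /Cintegral /= !Rintegral_cst// !mul0r. Qed.

Lemma Cintegral_sum n (F : 'I_n -> R -> R[i]) :
  (forall j, Cintegrable (F j)) ->
  Cintegrable (fun t => \sum_j F j t) /\
  Cintegral (fun t => \sum_j F j t) = \sum_j Cintegral (F j).
Proof.
elim: n F => [|n IH] F iF.
  rewrite big_ord0; under eq_fun do rewrite big_ord0.
  by split; [split; exact: integrable0|exact: Cintegral0].
have [iS ES] := IH (fun j => F (widen_ord (leqnSn n) j)) (fun j => iF _).
rewrite big_ord_recr /= -ES; under eq_fun do rewrite big_ord_recr /=.
by split; [exact: CintegrableD|exact: CintegralD].
Qed.

End ComplexIntegral.

(** * Fourier transform of fast decaying functions *)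

Section Fourier.
Context {R : realType}.
Implicit Types r s : R -> R.
Local Notation mu := (@lebesgue_measure R).

(** The sign of the phase and the absence of a normalizing factor are those of
    the integrals in the theorem: this is the usual transform at [- a]. *)
Definition fourier (a : R) (r : R -> R) : R[i] :=
  Cintegral (fun t => expi (a * t) * (r t)%:C).

Lemma fourierE a r :
  fourier a r = (\int[mu]_t (cos (a * t) * r t)) +i*
                (\int[mu]_t (sin (a * t) * r t)).
Proof.
rewrite /fourier /Cintegral; congr (_ +i* _); apply: eq_Rintegral => t _ /=.
  by rewrite mulr0 subr0.
by rewrite mulr0 add0r.
Qed.

Lemma normr_cos_le1 (t : R) : `|cos t| <= 1.
Proof. by rewrite ler_norml cos_geN1 cos_le1. Qed.

Lemma normr_sin_le1 (t : R) : `|sin t| <= 1.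
Proof. by rewrite ler_norml sin_geN1 sin_le1. Qed.

Lemma fast_decay_cos a r : fast_decay r ->
  fast_decay (fun t => cos (a * t) * r t).
Proof.
apply: (@fast_decayMb _ (fun t => cos (a * t)) _ 1) => [t|t].
  apply: (@continuous_comp _ _ _ ( *%R a) cos); last exact: continuous_cos.
  exact: mulrl_continuous.
exact: normr_cos_le1.
Qed.

Lemma fast_decay_sin a r : fast_decay r ->
  fast_decay (fun t => sin (a * t) * r t).
Proof.
apply: (@fast_decayMb _ (fun t => sin (a * t)) _ 1) => [t|t].
  apply: (@continuous_comp _ _ _ ( *%R a) sin); last exact: continuous_sin.
  exact: mulrl_continuous.
exact: normr_sin_le1.
Qed.

Lemma Cintegrable_fourier a r : fast_decay r ->
  Cintegrable (fun t => expi (a * t) * (r t)%:C).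
Proof.
move=> Dr; split.
  apply: eq_integrable (fast_decay_integrable (fast_decay_cos a Dr)) => //.
  move=> t _ /=.
  by rewrite mulr0 subr0.
apply: eq_integrable (fast_decay_integrable (fast_decay_sin a Dr)) => //.
move=> t _ /=.
by rewrite mulr0 add0r.
Qed.

Lemma fourierD a r s : fast_decay r -> fast_decay s ->
  fourier a (fun t => r t + s t) = fourier a r + fourier a s.
Proof.
move=> Dr Ds; rewrite /fourier -CintegralD; [|exact: Cintegrable_fourier..].
by congr Cintegral; apply/funext => t; rewrite rmorphD mulrDr.
Qed.

Lemma fourierZ a c r : fast_decay r ->
  fourier a (fun t => c * r t) = c%:C * fourier a r.
Proof.
move=> Dr; rewrite /fourier -CintegralZ; last exact: Cintegrable_fourier.
by congr Cintegral; apply/funext => t; rewrite rmorphM mulrCA.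
Qed.

(** Integration by parts, that is [Rintegral_derive0] for cos(at) r and
    sin(at) r. *)
Lemma fourier_derive a r r' : (forall t : R, is_derive t (1 : R) r (r' t)) ->
  fast_decay r -> fast_decay r' ->
  fourier a r' = - ((0 +i* a) * fourier a r).
Proof.
move=> dr Dr Dr'.
have int (p : R -> R) : fast_decay p -> mu.-integrable setT (EFin \o p).
  exact: fast_decay_integrable.
have Dc := fast_decay_cos a Dr; have Dc' := fast_decay_cos a Dr'.
have Ds := fast_decay_sin a Dr; have Ds' := fast_decay_sin a Dr'.
have Ec : \int[mu]_t (- a * (sin (a * t) * r t) + cos (a * t) * r' t) = 0.
  apply: (@Rintegral_derive0 _ (fun t => cos (a * t) * r t)) => // [t|].
    have drt := dr t; apply: is_derive_eq.
    by rewrite /GRing.scale /=; ring.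
  by apply: fast_decayD => //; exact: fast_decayZ.
have Es : \int[mu]_t (a * (cos (a * t) * r t) + sin (a * t) * r' t) = 0.
  apply: (@Rintegral_derive0 _ (fun t => sin (a * t) * r t)) => // [t|].
    have drt := dr t; apply: is_derive_eq.
    by rewrite /GRing.scale /=; ring.
  by apply: fast_decayD => //; exact: fast_decayZ.
move: Ec Es; rewrite !RintegralD//; try by apply: int => //; exact: fast_decayZ.
rewrite !RintegralZl//; try exact: int.
move=> Ec Es; rewrite !fourierE; simpc; congr (_ +i* _); lra.
Qed.

End Fourier.

(** * Fourier transform of a translated Gaussian *)

Section GaussianFourier.
Local Open Scope classical_set_scope.
Local Open Scope ring_scope.
Context {R : realType}.
Implicit Types r : R -> R.
Local Notation mu := (@lebesgue_measure R).

(** Differentiation under the integral sign for a kernel k(at); |t r t|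
    dominates the derivatives for all values of the parameter at once.  Sine and
    cosine are the two kernels in view. *)
Lemma is_derive_integral_param (k k' : R -> R) r : 
  (forall v : R, is_derive v (1 : R) k (k' v)) ->
  (forall v, `|k' v| <= 1) ->
  (forall a r, fast_decay r -> fast_decay (fun t => k (a * t) * r t)) ->
  fast_decay r ->
  forall a : R, is_derive a (1 : R) (fun a => \int[mu]_t (k (a * t) * r t))
    (\int[mu]_t (k' (a * t) * (t * r t))).
Proof.
move=> dk k'1 Dk Dr a.
have dkt (t b : R) : is_derive b (1 : R) (fun b => k (b * t) * r t)
    (k' (b * t) * (t * r t)).
  have dkb := dk (b * t); apply: is_derive_eq.
  by rewrite /GRing.scale /=; ring.
have p1 t b : partial1of2 (fun (b t : R) => k (b * t) * r t) b t =
    k' (b * t) * (t * r t).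
  by rewrite partial1of2E; case: (dkt t b).
have aI : a \in `]a - 1, a + 1[ by rewrite in_itv /= ltrBlDr ltrDl ltr01.
have H1 (b : R) : `]a - 1, a + 1[%classic b ->
    mu.-integrable setT (EFin \o (fun t => k (b * t) * r t)).
  by move=> _; exact/fast_decay_integrable/Dk.
have H2 (b t : R) : `]a - 1, a + 1[%classic b -> setT t ->
    derivable (fun b : R => k (b * t) * r t) b (1 : R).
  by move=> _ _; case: (dkt t b).
have H3 (t : R) : 0 <= `|t * r t| by [].
have H4 : mu.-integrable setT (EFin \o (fun t => `|t * r t|)).
  by apply/(@integrable_norm _ _ _ mu)/fast_decay_integrable/fast_decayX.
have H5 (b t : R) : `]a - 1, a + 1[%classic b -> setT t ->
    `|partial1of2 (fun b t : R => k (b * t) * r t) b t| <= `|t * r t|.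
  by move=> _ _; rewrite p1 normrM ler_piMl.
split; first exact: (derivable_under_integral measurableT aI H1 H2 H3 H4 H5).
rewrite -derive1E (differentiation_under_integral measurableT aI H1 H2 H3 H4 H5).
by apply: eq_Rintegral => t _; rewrite p1.
Qed.

Lemma is_derive_fourier_Re r : fast_decay r -> forall a : R,
  is_derive a (1 : R) (fun a => \int[mu]_t (cos (a * t) * r t))
    (- \int[mu]_t (sin (a * t) * (t * r t))).
Proof.
move=> Dr a; apply: is_derive_eq.
  apply: (@is_derive_integral_param _ (fun v => - sin v)) => // [v|b s Ds].
    by rewrite normrN normr_sin_le1.
  exact: fast_decay_cos.
rewrite -mulN1r -RintegralZl//; last first.
  exact/fast_decay_integrable/fast_decay_sin/fast_decayX.
by apply: eq_Rintegral => t _; rewrite mulN1r mulNr.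
Qed.

Lemma is_derive_fourier_Im r : fast_decay r -> forall a : R,
  is_derive a (1 : R) (fun a => \int[mu]_t (sin (a * t) * r t))
    (\int[mu]_t (cos (a * t) * (t * r t))).
Proof.
move=> Dr a; apply: is_derive_integral_param => // [v|b s Ds].
  exact: normr_cos_le1.
exact: fast_decay_sin.
Qed.

Lemma fast_decay_gauss : fast_decay (@gauss_fun R).
Proof.
rewrite (_ : gauss_fun = fun t => hermite_fun 0 t * hermite_fun 0 t).
  by apply: fast_decayM; exact: fast_decay_hermite.
apply/funext => t; rewrite hermite_fun0 -expRD /gauss_fun; congr expR.
by field.
Qed.

Lemma Rintegral_gauss_shift (c : R) :
  \int[mu]_t gauss_fun (t - c) = Num.sqrt pi.
Proof.
have dF (t : R) : is_derive t (1 : R) (fun t : R => t - c) 1.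
  by apply: is_derive_eq; rewrite subr0.
have F'E : (fun t : R => t - c)^`()%classic = cst 1.
  by apply/funext => t; rewrite derive1E; case: (dF t).
rewrite /Rintegral.
have -> : (\int[mu]_t (gauss_fun (t - c))%:E = (Num.sqrt pi)%:E)%E; last by [].
rewrite -integralT_gauss.
rewrite [RHS](@increasing_ge0_integration_by_substitutionT _ (fun t => t - c)).
- by apply: eq_integral => t _; rewrite F'E /= mulr1.
- by move=> t s ts; rewrite ltrD2r.
- by rewrite F'E => t; exact: cvg_cst.
- by rewrite F'E; exact: is_cvg_cst.
- by rewrite F'E; exact: is_cvg_cst.
- by move=> t; case: (dF t).
- exact: cvg_addrr_Ny.
- exact: cvg_addrr.
- exact: continuous_gauss_fun.
- by move=> t; exact: gauss_fun_ge0.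
Qed.

(** Write r for the translated Gaussian.  As r' = 2 (c - t) r, integration by
    parts expresses the transform of t r, which is -i times the derivative in
    [a] of the transform y of r, through y itself:  y' = (i c - a / 2) y.  The
    solution is y(a) = exp(i a c - a^2 / 4) y(0), and y(0) is the Gauss
    integral. *)
Lemma fourier_gauss_shift (c a : R) :
  fourier a (fun t => gauss_fun (t - c)) =
  expi (a * c) * (Num.sqrt pi * expR (- (a ^+ 2 / 4)))%:C.
Proof.
pose r (t : R) := gauss_fun (t - c).
have Dr : fast_decay r by exact/fast_decay_shift/fast_decay_gauss.
pose C b := \int[mu]_t (cos (b * t) * r t).
pose S b := \int[mu]_t (sin (b * t) * r t).
have dr (t : R) : is_derive t (1 : R) r (2 * c * r t + (- 2) * (t * r t)).
  have dg := is_derive_gauss (t - c).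
  by apply: is_derive_eq; rewrite /r subr0 mulr1; ring.
have DXr := fast_decayX Dr.
have D1 := fast_decayZ (2 * c) Dr.
have D2 := fast_decayZ (- 2) DXr.
have ode b : \int[mu]_t (cos (b * t) * (t * r t)) = c * C b - b / 2 * S b /\
             \int[mu]_t (sin (b * t) * (t * r t)) = c * S b + b / 2 * C b.
  have := fourier_derive b dr Dr (fast_decayD D1 D2).
  rewrite fourierD// !fourierZ// !fourierE -/(C b) -/(S b); simpc.
  by case; rewrite -/(C b) -/(S b) => eC eS; split; lra.
have dC (b : R) : is_derive b (1 : R) C (- (c * S b + b / 2 * C b)).
  by have [_ <-] := ode b; exact: is_derive_fourier_Re.
have dS (b : R) : is_derive b (1 : R) S (c * C b - b / 2 * S b).
  by have [<- _] := ode b; exact: is_derive_fourier_Im.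
(* real and imaginary parts of exp(b^2/4 - i b c) (C b + i S b), which are
   constant *)
pose P b := expR (b ^+ 2 / 4) * (cos (b * c) * C b + sin (b * c) * S b).
pose Q b := expR (b ^+ 2 / 4) * (cos (b * c) * S b - sin (b * c) * C b).
have dP (b : R) : is_derive b (1 : R) P 0.
  have dCb := dC b; have dSb := dS b; apply: is_derive_eq.
  by rewrite /GRing.scale /=; field.
have dQ (b : R) : is_derive b (1 : R) Q 0.
  have dCb := dC b; have dSb := dS b; apply: is_derive_eq.
  by rewrite /GRing.scale /=; field.
have P0 : P a = Num.sqrt pi.
  rewrite (is_derive_0_is_cst a 0 dP) /P !mul0r expr0n /= mul0r.
  rewrite expR0 cos0 sin0 !mul1r mul0r addr0 -(Rintegral_gauss_shift c).
  by apply: eq_Rintegral => t _; rewrite mul0r cos0 mul1r.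
have Q0 : Q a = 0.
  rewrite (is_derive_0_is_cst a 0 dQ) /Q !mul0r expr0n /= mul0r.
  rewrite expR0 cos0 sin0 !mul1r mul0r subr0 /S.
  rewrite (@eq_Rintegral _ _ _ _ _ (cst 0)) ?Rintegral_cst ?mul0r//.
  by move=> t _; rewrite mul0r sin0 mul0r.
rewrite fourierE -/(C a) -/(S a) /expi; simpc.
have e0 := expR_gt0 (a ^+ 2 / 4).
have cs := cos2Dsin2 (a * c).
rewrite -P0 expRN.
have -> : C a = cos (a * c) * (P a * (expR (a ^+ 2 / 4))^-1) -
                sin (a * c) * (Q a * (expR (a ^+ 2 / 4))^-1).
  by rewrite /P /Q -[LHS]mul1r -[X in X * _ = _]cs; field; rewrite gt_eqF.
have -> : S a = sin (a * c) * (P a * (expR (a ^+ 2 / 4))^-1) +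
                cos (a * c) * (Q a * (expR (a ^+ 2 / 4))^-1).
  by rewrite /P /Q -[LHS]mul1r -[X in X * _ = _]cs; field; rewrite gt_eqF.
by rewrite Q0 !mul0r !mulr0 subr0 addr0.
Qed.

End GaussianFourier.

(** * Transforms of products of two Hermite functions *)

Section HermitePairs.
Context {R : realType}.
Local Notation h := (@hermite_fun R).

(** With [e = 1] this is the product integrated in the short-time Fourier
    transform, with [e = -1] the one integrated in the convolution; the condition
    [e ^+ 2 = 1] lets the same computation serve both. *)
Definition hermite_pair (e p q : R) (k m : nat) (t : R) : R :=
  h k (t - p) * h m (e * (t - q)).

Lemma fast_decay_hermite_pair e p q k m : e ^+ 2 = 1 ->
  fast_decay (hermite_pair e p q k m).
Proof.
move=> e2; apply: fast_decayM.
  exact: fast_decay_shift (fast_decay_hermite k).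
apply: (@fast_decay_shift _ (fun t => h m (e * t))).
apply: (@fast_decay_comp _ _ _ 0) (fast_decay_hermite m) => [|t].
  exact: mulrl_continuous.
by rewrite add0r normrM -(sqrtr_sqr e) e2 sqrtr1 mul1r.
Qed.

Lemma is_derive_hermite_pair e p q k m (t : R) :
  is_derive t (1 : R) (hermite_pair e p q k m)
    (((t - p) * h k (t - p) - h k.+1 (t - p)) * h m (e * (t - q)) +
     e * h k (t - p) * (e * (t - q) * h m (e * (t - q)) - h m.+1 (e * (t - q)))).
Proof.
have dk := is_derive_hermite k (t - p).
have dm := is_derive_hermite m (e * (t - q)).
rewrite /hermite_pair; apply: is_derive_eq.
by rewrite /GRing.scale /=; ring.
Qed.

(** Differentiate the product with the raising form for the factor of index k
    and the lowering form for the factor of index m.  The terms (t - p) and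
    - e^2 (t - q) add up to the constant q - p, so the derivative is a combination
    of products of the same kind, and integrating by parts gives the
    recurrence. *)
Lemma fourier_hermite_pairSl a e p q k m : e ^+ 2 = 1 ->
  fourier a (hermite_pair e p q k.+1 m) =
  ((q - p) +i* a) * fourier a (hermite_pair e p q k m) +
  (2 * m%:R * e)%:C * fourier a (hermite_pair e p q k m.-1).
Proof.
move=> e2; have D := fast_decay_hermite_pair p q _ _ e2.
have D0 := fast_decayZ (q - p) (D k m).
have D1 := fast_decayZ (-1) (D k.+1 m).
have D2 := fast_decayZ (2 * m%:R * e) (D k m.-1).
have dr (t : R) : is_derive t (1 : R) (hermite_pair e p q k m)
    ((q - p) * hermite_pair e p q k m t +
     (-1 * hermite_pair e p q k.+1 m t +
      2 * m%:R * e * hermite_pair e p q k m.-1 t)).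
  apply: is_derive_eq (is_derive_hermite_pair e p q k m t) _.
  rewrite /hermite_pair (hermite_funS m).
  transitivity ((t - p - e ^+ 2 * (t - q)) * h k (t - p) * h m (e * (t - q)) -
    h k.+1 (t - p) * h m (e * (t - q)) +
    2 * m%:R * e * h k (t - p) * h m.-1 (e * (t - q))); first by ring.
  by rewrite e2; ring.
have := fourier_derive a dr (D k m) (fast_decayD D0 (fast_decayD D1 D2)).
rewrite fourierD ?fourierZ//; last exact: fast_decayD.
rewrite fourierD ?fourierZ//.
rewrite (_ : (q - p) +i* a = (q - p)%:C + (0 +i* a)); last by simpc.
set T := fourier a (hermite_pair e p q k m) => E.
rewrite mulrDl -[(0 +i* a) * T]opprK -E rmorphN rmorph1; ring.
Qed.

(** The same computation, with the roles of the two factors exchanged. *)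
Lemma fourier_hermite_pairSr a e p q k m : e ^+ 2 = 1 ->
  fourier a (hermite_pair e p q k m.+1) =
  e%:C * (((p - q) +i* a) * fourier a (hermite_pair e p q k m) +
          (2 * k%:R)%:C * fourier a (hermite_pair e p q k.-1 m)).
Proof.
move=> e2; have D := fast_decay_hermite_pair p q _ _ e2.
have D0 := fast_decayZ (p - q) (D k m).
have D1 := fast_decayZ (- e) (D k m.+1).
have D2 := fast_decayZ (2 * k%:R) (D k.-1 m).
have dr (t : R) : is_derive t (1 : R) (hermite_pair e p q k m)
    ((p - q) * hermite_pair e p q k m t +
     (- e * hermite_pair e p q k m.+1 t +
      2 * k%:R * hermite_pair e p q k.-1 m t)).
  apply: is_derive_eq (is_derive_hermite_pair e p q k m t) _.
  rewrite /hermite_pair (hermite_funS k).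
  transitivity ((e ^+ 2 * (t - q) - (t - p)) * h k (t - p) * h m (e * (t - q)) -
    e * h k (t - p) * h m.+1 (e * (t - q)) +
    2 * k%:R * h k.-1 (t - p) * h m (e * (t - q))); first by ring.
  by rewrite e2; ring.
have := fourier_derive a dr (D k m) (fast_decayD D0 (fast_decayD D1 D2)).
rewrite fourierD ?fourierZ//; last exact: fast_decayD.
rewrite fourierD ?fourierZ//.
rewrite (_ : (p - q) +i* a = (p - q)%:C + (0 +i* a)); last by simpc.
set T := fourier a (hermite_pair e p q k m) => E.
have e2C : e%:C * e%:C = 1 by rewrite -rmorphM -expr2 e2.
rewrite mulrDl -[(0 +i* a) * T]opprK -E rmorphN.
rewrite -[LHS]mul1r -e2C; ring.
Qed.

(** Completing the square: the product of the two Gaussians is a Gaussian centred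
    at (p + q) / 2, damped by exp(-(p - q)^2 / 4).  The result depends on [a] and
    [p - q] only through the sum of their squares, apart from the phase; this
    symmetry is the initial case of the duality below. *)
Lemma fourier_hermite_pair00 a e p q : e ^+ 2 = 1 ->
  fourier a (hermite_pair e p q 0 0) =
  expi (a * ((p + q) / 2)) *
    (Num.sqrt pi * expR (- ((a ^+ 2 + (p - q) ^+ 2) / 4)))%:C.
Proof.
move=> e2.
have -> : hermite_pair e p q 0 0 = fun t =>
    expR (- ((p - q) ^+ 2 / 4)) * gauss_fun (t - (p + q) / 2).
  apply/funext => t; rewrite /hermite_pair !hermite_fun0 /gauss_fun. rewrite -!expRD.
  by congr expR; rewrite exprMn e2; field.
rewrite fourierZ; last exact/fast_decay_shift/fast_decay_gauss.
rewrite fourier_gauss_shift mulrCA -rmorphM [_ * (Num.sqrt pi * _)]mulrCA -expRD.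
by congr (_ * (_ * expR _)%:C); field.
Qed.

(** Both sides satisfy the same recurrences.  Raising k brings the coefficient
    (u - x) + i l on the left and l + i (x - u) on the right, and the former is
    i times the latter; the lowered term has the sign e = 1 on the left and
    e = -1 = i^2 on the right, which accounts for its total index being smaller by
    2.  Hence the factor i^(k + m). *)
Lemma fourier_hermite_pair_dual l x u k m :
  fourier l (hermite_pair 1 x u k m) =
  (0 +i* 1) ^+ (k + m) *
    (expi (u * l) * fourier (x - u) (hermite_pair (-1) 0 l k m)).
Proof.
have e1 : (1 : R) ^+ 2 = 1 by rewrite expr1n.
have eN1 : (-1 : R) ^+ 2 = 1 by rewrite sqrrN.
have i2 : (0 +i* 1) * (0 +i* 1) = -1 :> R[i] by simpc.
(* k = 0 is treated by raising m, where no lowered term occurs *)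
elim: k m => [|k IH] m.
  elim: m => [|m IH].
    rewrite addn0 expr0 mul1r !fourier_hermite_pair00//.
    rewrite [RHS]mulrA -expiD; congr (expi _ * (_ * expR _)%:C); by field.
  rewrite !fourier_hermite_pairSr// IH !add0n exprS !mulr0 !mul0r !addr0.
  have -> : (x - u) +i* l = (0 +i* 1) * (- ((0 - l) +i* (x - u))) by simpc.
  by rewrite rmorphN rmorph1; ring.
rewrite !fourier_hermite_pairSl// IH.
have -> : (u - x) +i* l = (0 +i* 1) * ((l - 0) +i* (x - u)).
  by simpc.
(* for m = 0 the lowered term has coefficient 0 *)
case: m => [|m] /=.
  by rewrite !mulr0 !mul0r !addr0 exprS; ring.
rewrite IH !addSn !addnS !exprS.
set z := (l - 0) +i* (x - u); set F := fourier _ _; set G := fourier _ _.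
set w := expi _; set I := 0 +i* 1; set P := _ ^+ (k + m).
transitivity (I * z * (I * P * (w * F)) + (2 * m.+1%:R)%:C * (P * (w * G))).
  by rewrite mulr1.
transitivity (I * (I * P) * (w * (z * F)) -
   (I * I) * (2 * m.+1%:R)%:C * (P * (w * G))).
  by rewrite i2; ring.
by rewrite mulrN1 rmorphN; ring.
Qed.

End HermitePairs.

(** * The short-time Fourier transform of a superoscillating signal *)

Theorem theorem5p3 (R : realType) (a : R) (ha : 1 < a)
    (n : nat) (hn : (1 <= n)%N) (x u eta : R) (k m : nat) :
  stft (hermite_funC m) (fun t => superosc_signal n k x t a) u eta =
  (0 +i* 1) ^+ (k + m) *
  \sum_(j < n.+1) (so_coef n a j)%:C *
    convol (modulation x (hermite_funC k)) (modulation u (hermite_funC m))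
      (so_freq R n j - eta).
Proof.
pose r := hermite_pair 1 x u k m.
have Dr : fast_decay r by apply: fast_decay_hermite_pair; rewrite expr1n.
have stftE : stft (hermite_funC m) (fun t => superosc_signal n k x t a) u eta =
    \sum_(j < n.+1) (so_coef n a j)%:C * fourier (so_freq R n j - eta) r.
  have If b : Cintegrable (fun t => expi (b * t) * (r t)%:C).
    exact: Cintegrable_fourier.
  have [_ sumE] := Cintegral_sum (fun j : 'I_n.+1 =>
    CintegrableZ (so_coef n a j)%:C (If (so_freq R n j - eta))).
  under eq_bigr do rewrite /fourier -CintegralZ//.
  rewrite -sumE.
  congr Cintegral; apply/funext => t.
  rewrite /superosc_signal /superosc /hermite_funC conjc_real !mulr_sumr.
  apply: eq_bigr => j _.
  have -> : (so_freq R n j - eta) * t = - (t * eta) + so_freq R n j * t by ring.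
  rewrite expiD /r /hermite_pair mul1r (rmorphM _ (hermite_fun k _)); ring.
rewrite stftE mulr_sumr; apply: eq_bigr => j _.
(* what remains is the convolution with its constant phase exp(i u l) taken
   out of the integral *)
rewrite fourier_hermite_pair_dual mulrCA; congr (_ * (_ * _)).
rewrite /fourier -CintegralZ; last first.
  by apply/Cintegrable_fourier/fast_decay_hermite_pair; rewrite sqrrN expr1n.
congr Cintegral; apply/funext => s.
rewrite /modulation /hermite_funC /hermite_pair subr0 mulN1r opprB.
rewrite (rmorphM _ (hermite_fun k _)).
set l := so_freq R n j - eta.
have -> : x * s = (x - u) * s + u * s by ring.
have -> : u * l = u * (l - s) + u * s by ring.
by rewrite !expiD; ring.
Qed.
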